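(* There exists a function $g$ on graphs with $g(H) = \mathcal{O}(|V(H)| \cdot \sqrt{\log |V(H)|})$ such that the following holds. Let $H$ be a graph, let $G$ be a finite graph that does not contain $H$ as a minor, and let $A,B \subseteq V(G)$. Then for every positive integer $k$, either there exists a collection of $k$ vertex-disjoint and pairwise anticomplete $(A,B)$-paths in $G$, or there exists an $(A,B)$-separator in $G$ of size at most $k \cdot g(H)$.
   Context: Graphs are finite and simple. $G$ contains $H$ as a minor if $H$ can be obtained from a subgraph of $G$ by edge contractions. A path is a non-empty sequence $v_1,\ldots,v_\ell$ of distinct vertices in which consecutive vertices are adjacent; it is an $(A,B)$-path if $v_1 \in A$ and $v_\ell \in B$. Two paths are anticomplete if there is no edge between a vertex of one and a vertex of the other. A set $S \subseteq V(G)$ is an $(A,B)$-separator if every $(A,B)$-path contains a vertex of $S$. *)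

(* Defs.v *)
From HB Require Import structures.
From mathcomp Require Import all_boot all_order all_algebra.
From mathcomp Require Import all_classical all_reals all_analysis.

Set Implicit Arguments.
Unset Strict Implicit.
Unset Printing Implicit Defensive.

Record sgraph := SGraph {
  vertex :> finType;
  adj : rel vertex;
  adj_sym : symmetric adj;
  adj_irrefl : irreflexive adj
}.

Definition isomorphic (G H : sgraph) : Prop :=
  exists2 f : G -> H, bijective f & forall x y, adj (f x) (f y) = adj x y.

(* [S] is, up to isomorphism, a (not necessarily induced) subgraph of [G]. *)
Definition subgraph (S G : sgraph) : Prop :=
  exists2 f : S -> G, injective f & forall x y, adj x y -> adj (f x) (f y).

Section Contraction.
Variables (G : sgraph) (u v : G).

(* The vertex [v] is removed and [u] plays the role of the vertex obtained by
   merging [u] and [v]; loops and parallel edges are suppressed. *)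
Definition contract_adj : rel {x : G | x != v} := fun x y =>
  (x != y) &&
  [|| adj (val x) (val y),
      (val x == u) && adj v (val y)
    | (val y == u) && adj v (val x)].

Lemma contract_adj_sym : symmetric contract_adj.
Proof.
move=> x y; rewrite /contract_adj eq_sym adj_sym; congr (_ && (_ || _)).
exact: orbC.
Qed.

Lemma contract_adj_irrefl : irreflexive contract_adj.
Proof. by move=> x; rewrite /contract_adj eqxx. Qed.

Definition contract : sgraph := SGraph contract_adj_sym contract_adj_irrefl.

End Contraction.

Inductive contracts_to (G H : sgraph) : Prop :=
| contracts_iso of isomorphic G H
| contracts_edge (u v : G) of adj u v & contracts_to (contract u v) H.

Definition minor (H G : sgraph) : Prop :=
  exists2 S : sgraph, subgraph S G & contracts_to S H.

Section Paths.
Variable G : sgraph.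

Definition is_path (s : seq G) : bool :=
  if s is x :: p then path (@adj G) x p && uniq s else false.

Definition is_ABpath (A B : {set G}) (s : seq G) : bool :=
  is_path s && (if s is x :: p then (x \in A) && (last x p \in B) else false).

Definition vertex_disjoint (p q : seq G) : Prop :=
  forall x, ~ (x \in p /\ x \in q).

Definition anticomplete (p q : seq G) : Prop :=
  forall x y, x \in p -> y \in q -> ~~ adj x y.

Definition separator (A B S : {set G}) : Prop :=
  forall p, is_ABpath A B p -> exists2 x, x \in p & x \in S.

End Paths.

(* Main.v *)
Require Import Defs.
From HB Require Import structures.
From mathcomp Require Import all_classical all_reals all_analysis.
From mathcomp Require Import all_boot all_order all_algebra.
From mathcomp Require Import zify.

Set Implicit Arguments.
Unset Strict Implicit.
Unset Printing Implicit Defensive.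

(* With t = |H|, Menger's theorem gives either an (A,B)-separator with fewer
   than 2tk vertices or 2tk disjoint (A,B)-paths. In the second case, join two
   paths when an edge of G links them. By the argument of Duchet and Meyniel, a
   graph on 2tk vertices contains K_t as a minor or has k pairwise non-adjacent
   vertices; the former would make H a minor of G, so the latter holds and
   yields k pairwise anticomplete paths. The function g(H) = 2|H| is even
   linear. *)

Import Order.TTheory GRing.Theory Num.Theory.

(** * Menger's theorem for directed graphs, by deletion of arcs *)

Section Walks.
Variable T : finType.
Implicit Types (e : rel T) (A B S P Q : {set T}) (a x y : T) (p : seq T).

(** Vertices may repeat, so that pieces of walks can be spliced freely; distinctness is imposed only
    in [linkage]. *)
Definition walk e A B x p := [&& path e x p, x \in A & last x p \in B].

Definition walk_separator e A B S :=
  forall x p, walk e A B x p -> exists2 z, z \in x :: p & z \in S.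

Definition linkage e A B k (x : 'I_k -> T) (p : 'I_k -> seq T) :=
  (forall i, walk e A B (x i) (p i) /\ uniq (x i :: p i)) /\
  (forall i j z, z \in x i :: p i -> z \in x j :: p j -> i = j).

(** A single ordered pair is deleted, in keeping with arcs being directed. *)
Definition del_arc e x y : rel T := [rel a b | e a b && ((a, b) != (x, y))].

Lemma path_del_arc e x y a p : path e a p ->
  path (del_arc e x y) a p \/ x \in belast a p /\ y \in p.
Proof.
elim: p a => [|b p IH] a /=; first by left.
case/andP=> eab /IH [pb|[xb yp]]; last by right; rewrite !inE xb yp !orbT.
case: (altP ((a, b) =P (x, y))) => [[-> ->]|ne]; first by right;
  rewrite !inE !eqxx.
by left; rewrite pb andbT /del_arc /= eab.
Qed.

Lemma path_del_arcW e x y a p : path (del_arc e x y) a p -> path e a p.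
Proof. by apply: sub_path => u v /andP[]. Qed.

Lemma split_first P a p z : z \in a :: p -> z \in P ->
  exists p1 p2, [/\ p = p1 ++ p2, last a p1 \in P
    & {in belast a p1, forall b, b \notin P}].
Proof.
elim: p a => [|b p IH] a zp zP.
  by exists [::], [::]; move: zp; rewrite inE => /eqP <-.
case aP: (a \in P); first by exists [::], (b :: p).
move: zp; rewrite inE => /predU1P[za|zp]; first by rewrite -za zP in aP.
have [p1 [p2 [-> lP bP]]] := IH b zp zP.
exists (b :: p1), p2; split=> // c; rewrite /= inE => /predU1P[->|/bP//].
by rewrite aP.
Qed.

Lemma split_last P a p z : z \in a :: p -> z \in P ->
  exists p1 p2, [/\ p = p1 ++ p2, last a p1 \in P
    & {in p2, forall b, b \notin P}].
Proof.
elim/last_ind: p => [|p b IH] zp zP.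
  by exists [::], [::]; move: zp; rewrite inE => /eqP <-.
case bP: (b \in P); first by exists (rcons p b), [::]; rewrite cats0 last_rcons.
move: zp; rewrite -rcons_cons mem_rcons inE => /predU1P[zb|zp].
  by rewrite -zb zP in bP.
have [p1 [p2 [-> lP pP]]] := IH zp zP.
exists p1, (rcons p2 b); rewrite rcons_cat; split=> // c.
by rewrite mem_rcons inE => /predU1P[->|/pP//]; rewrite bP.
Qed.

Lemma split_mem a p z : z \in a :: p ->
  exists p1 p2, p = p1 ++ p2 /\ last a p1 = z.
Proof.
move=> zp; have [p1 [p2 [-> /set1P]]] := split_first zp (set11 z).
by exists p1, p2.
Qed.

Lemma walk_separator_tail e A B S x y : walk_separator (del_arc e x y) A B S ->
  walk_separator e A B (x |: S).
Proof.
move=> sS a p /and3P[pp aA lB].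
case: (path_del_arc x y pp) => [pp'|[xp _]].
  have [|z zp zS] := sS a p; first by apply/and3P.
  by exists z => //; rewrite inE zS orbT.
by exists x; [exact: mem_belast | rewrite setU11].
Qed.

Lemma walk_separator_head e A B S x y : walk_separator (del_arc e x y) A B S ->
  walk_separator e A B (y |: S).
Proof.
move=> sS a p /and3P[pp aA lB].
case: (path_del_arc x y pp) => [pp'|[_ yp]].
  have [|z zp zS] := sS a p; first by apply/and3P.
  by exists z => //; rewrite inE zS orbT.
by exists y; [rewrite inE yp orbT | rewrite setU11].
Qed.

(** Cut a walk at its first vertex in [P]. Since [x] lies in [P], this piece never leaves [x], so it
    avoids the deleted arc and must meet [R]. *)
Lemma walk_separator_to_tail e A B P R x y : x \in P ->
    walk_separator e A B P -> walk_separator (del_arc e x y) A P R ->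
  walk_separator e A B R.
Proof.
move=> xP sP sR a p wp; have [z zp zP] := sP a p wp.
have [p1 [p2 [dp lP bP]]] := split_first zp zP.
case/and3P: wp; rewrite {}dp cat_path => /andP[pp1 _] aA _.
have [|w wp wR] := sR a p1; last by exists w; rewrite // -cat_cons mem_cat wp.
apply/and3P; split=> //; case: (path_del_arc x y pp1) => // -[/bP].
by rewrite xP.
Qed.

(** Mirror image: after its last visit to [Q] a walk never enters [y], so the remaining piece avoids
    the deleted arc. *)
Lemma walk_separator_from_head e A B Q R x y : y \in Q ->
    walk_separator e A B Q -> walk_separator (del_arc e x y) Q B R ->
  walk_separator e A B R.
Proof.
move=> yQ sQ sR a p wp; have [z zp zQ] := sQ a p wp.
have [p1 [p2 [dp lP bP]]] := split_last zp zQ.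
case/and3P: wp; rewrite {}dp cat_path last_cat => /andP[_ pp2] aA lB.
have [|w wp wR] := sR (last a p1) p2.
  apply/and3P; split=> //; case: (path_del_arc x y pp2) => // -[_ /bP].
  by rewrite yQ.
exists w => //; rewrite -cat_cons mem_cat.
by move: wp; rewrite inE => /predU1P[->|->]; rewrite ?orbT // mem_last.
Qed.

Lemma linkage_last_inj e A B k (x : 'I_k -> T) (p : 'I_k -> seq T) :
  linkage e A B x p -> injective (fun i => last (x i) (p i)).
Proof.
move=> [_ dis] i j eq_l; apply: (dis i j _ (mem_last _ _)).
by rewrite eq_l mem_last.
Qed.

Lemma linkage_head_inj e A B k (x : 'I_k -> T) (p : 'I_k -> seq T) :
  linkage e A B x p -> injective x.
Proof.
by move=> [_ dis] i j eq_h; apply: (dis i j (x i)); rewrite ?eq_h mem_head.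
Qed.

(** Removing loops only shrinks the vertex set of each walk, so disjointness survives. *)
Lemma shorten_linkage e A B k (x : 'I_k -> T) (p : 'I_k -> seq T) :
    (forall i, walk e A B (x i) (p i)) ->
    (forall i j z, z \in x i :: p i -> z \in x j :: p j -> i = j) ->
  exists (y : 'I_k -> T) (q : 'I_k -> seq T), linkage e A B y q.
Proof.
move=> wp dis; exists x.
have /fin_all_exists[q hq] i : exists q, [/\ walk e A B (x i) q, uniq (x i :: q)
    & {subset x i :: q <= x i :: p i}].
  case/and3P: (wp i); case/shortenP=> q pq uq sq aA lB.
  exists q; split=> //; first exact/and3P.
  by move=> z; rewrite !inE => /orP[->//|/sq ->]; rewrite orbT.
exists q; split=> [i|i j z]; first by case: (hq i).
have [_ _ si] := hq i; have [_ _ sj] := hq j.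
by move=> /si zi /sj zj; apply: dis zi zj.
Qed.

Lemma inj_onto k (f : 'I_k -> T) P : injective f -> (forall i, f i \in P) ->
  #|P| = k -> forall z, z \in P -> exists i, f i = z.
Proof.
move=> injf fP cP z zP.
have /setP/(_ z) : [set f i | i in 'I_k] = P.
  apply/eqP; rewrite eqEcard card_imset // cardT size_enum_ord cP leqnn andbT.
  by apply/subsetP=> _ /imsetP[i _ ->].
by rewrite zP => /imsetP[i _ ->]; exists i.
Qed.

(* The two linkages saturate their frontiers, so they can only meet in [S];
   the walk ending at [x] is continued through the deleted arc. *)
Lemma linkage_glue e A B S x y k (u v : 'I_k -> T) (p q : 'I_k -> seq T) :
    e x y -> walk_separator (del_arc e x y) A B S ->
    #|x |: S| = k -> #|y |: S| = k -> y \notin S ->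
    linkage (del_arc e x y) A (x |: S) u p ->
    linkage (del_arc e x y) (y |: S) B v q ->
  exists (w : 'I_k -> T) (r : 'I_k -> seq T), linkage e A B w r.
Proof.
move=> exy sS cP cQ yS lp lq.
have [[wp disp] [wq disq]] := (lp, lq).
pose l i := last (u i) (p i).
have lP i : l i \in x |: S by have [/and3P[]] := wp i.
have vQ i : v i \in y |: S by have [/and3P[]] := wq i.
have ontoP := inj_onto (linkage_last_inj lp) lP cP.
have ontoQ := inj_onto (linkage_head_inj lq) vQ cQ.
have meetP i z : z \in u i :: p i -> z \in x |: S -> z = l i.
  move=> zi /ontoP[j lj]; rewrite -lj; congr l; apply: (disp _ _ z) zi.
  by rewrite -lj mem_last.
have meetQ i z : z \in v i :: q i -> z \in y |: S -> z = v i.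
  move=> zi /ontoQ[j vj]; rewrite -vj; congr v; apply: (disq _ _ z) zi.
  by rewrite -vj mem_head.
(* At a shared vertex outside [S] one could switch from [p i] to [q j]; the resulting walk from [A]
   to [B] meets [S] in the last vertex of [p i] or the first of [q j], which would then be [z]
   itself or occur twice. *)
have meet i j z : z \in u i :: p i -> z \in v j :: q j -> z \in S.
  move=> zi zj; apply/negPn/negP=> zS.
  have [p1 [p2 [dp lp1]]] := split_mem zi.
  have [q1 [q2 [dq lq1]]] := split_mem zj.
  have [/and3P[pp uA _] up] := wp i; have [/and3P[pq _ vB] uq] := wq j.
  have [|s sp sin] := sS (u i) (p1 ++ q2).
    apply/and3P; move: pp pq vB; rewrite dp dq !cat_path !last_cat lp1 lq1.
    by move=> /andP[-> _] /andP[_ ->] ->.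
  move: sp; rewrite -cat_cons mem_cat => /orP[s1|s2].
    have sl : s = l i.
      by apply: meetP; rewrite ?(setU1r _ sin) // dp -cat_cons mem_cat s1.
    case: p2 dp => [|c p2] dp;
      first by rewrite sl /l dp cats0 lp1 (negPf zS) in sin.
    move: up; rewrite dp -cat_cons cat_uniq => /and3P[_ /hasPn/(_ s) h _].
    by move: h; rewrite /= s1; case/(_ _)/negP;
      rewrite // sl /l dp last_cat /= mem_last.
  have sv : s = v j.
    by apply: meetQ; rewrite ?(setU1r _ sin) // dq -cat_cons mem_cat s2 orbT.
  by move: uq; rewrite dq /= mem_cat -sv s2 orbT.
(* [f] pairs each first part with the second part that starts where it ends, except that the end [x]
   is paired with the start [y]. *)
have /fin_all_exists[f fE] i : exists j, v j = if l i == x then y else l i.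
  apply: ontoQ; case: eqP => [_|/eqP nx]; first exact: setU11.
  by move: (lP i); rewrite !inE (negPf nx) /= => ->; rewrite orbT.
(* The head [v (f i)] is a new vertex only across the deleted arc; otherwise it equals [l i] and
   must not be listed twice. *)
pose r i := p i ++ (if l i == x then v (f i) :: q (f i) else q (f i)).
have memr i z : z \in u i :: r i -> z \in u i :: p i \/ z \in v (f i) :: q (f i).
  rewrite /r -cat_cons mem_cat => /orP[->|]; first by left.
  by case: ifP => _ zq; right; rewrite // inE zq orbT.
have cross i j z : z \in u i :: p i -> z \in v (f j) :: q (f j) -> i = j.
  move=> zi zj; have zS := meet _ _ _ zi zj.
  have zl := meetP _ _ zi (setU1r x zS); have := meetQ _ _ zj (setU1r y zS).
  rewrite fE; case: eqP => [_ zy|_ zlj]; first by rewrite -zy zS in yS.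
  by apply: (linkage_last_inj lp); rewrite -/(l i) -zl zlj.
apply: (@shorten_linkage _ _ _ _ u r) => [i|i j z].
  have [/and3P[pp uA _] _] := wp i; have [/and3P[pq _ vB] _] := wq (f i).
  apply/and3P; split=> //; rewrite /r ?last_cat ?cat_path -/(l i).
    rewrite (path_del_arcW pp) /=; move: (path_del_arcW pq) (fE i).
    by case: eqP => [-> /= -> ->|_ pq' <-//]; rewrite exy.
  by move: vB (fE i); case: eqP => //= _ vB <-.
move=> /memr[zi|zi] /memr[zj|zj]; [exact: disp zi zj|exact: cross zi zj| |].
  by apply/esym/(cross _ _ _ zj zi).
have /eqP := disq _ _ _ zi zj; rewrite -(inj_eq (linkage_head_inj lq)) !fE.
move/eqP=> h; apply: (linkage_last_inj lp); rewrite -/(l i) -/(l j); move: h.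
(* If exactly one of the two ends is [x], the other equals [y] and lies in [S], contradicting
   [yS]. *)
case: eqP => [->|nx]; case: eqP => [->|nx'] // h.
- by move: (lP j) nx' yS; rewrite h !inE => /predU1P[->|->].
- by move: (lP i) nx yS; rewrite -h !inE => /predU1P[->|->].
Qed.

(** Induction on the number of arcs. After deleting an arc from [x] to [y], a separator [S] with
    fewer than [k] vertices becomes one for [e] once [x] or [y] is added. If both enlarged sets have
    at least [k] vertices, induction applies between [A] and the first, and between the second and
    [B]: a small separator on either side also separates [A] from [B], and two linkages can be
    glued. *)
Theorem menger e A B k :
  (exists2 S, walk_separator e A B S & #|S| < k) \/
  (exists (x : 'I_k -> T) (p : 'I_k -> seq T), linkage e A B x p).
Proof.
pose arcs e := [set a : T * T | e a.1 a.2].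
have [n] := ubnP #|arcs e|.
elim: n e A B => // n IH e A B /ltnSE le_n.
(* Without arcs the only walks are single vertices of [A :&: B]. *)
have [e0|[[x y]]] := set_0Vmem (arcs e).
  have [lt_k|le_k] := ltnP #|A :&: B| k.
    left; exists (A :&: B) => // a [|b p] /and3P[/= pp aA lB].
      by exists a; rewrite ?mem_head // inE aA.
    case/andP: pp => eab _; have : (a, b) \in arcs e by rewrite inE.
    by rewrite e0 inE.
  right; exists (fun i => enum_val (widen_ord le_k i)), (fun=> [::]).
  split=> [i|i j z]; last first.
    by rewrite !inE => /eqP-> /eqP/enum_val_inj/(congr1 val) /= /val_inj.
  by have := enum_valP (widen_ord le_k i); rewrite inE => /andP[hA hB]; split;
    rewrite // /walk /= hA.
rewrite inE /= => exy; set e' := del_arc e x y.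
have lt_n : #|arcs e'| < n.
  apply: leq_trans le_n; apply: proper_card; apply/properP; split.
    by apply/subsetP=> a; rewrite !inE => /andP[].
  by exists (x, y); rewrite !inE //= /e' /del_arc /= eqxx andbF.
case: (IH e' A B lt_n) => [[S sS cS]|[u [p [wp dp]]]]; last first.
  right; exists u, p; split=> // i; have [/and3P[pp aA lB] uq] := wp i.
  by split=> //; apply/and3P; rewrite (path_del_arcW pp).
have sP := walk_separator_tail sS; have sQ := walk_separator_head sS.
have [cP|cP] := ltnP #|x |: S| k; first by left; exists (x |: S).
have [cQ|cQ] := ltnP #|y |: S| k; first by left; exists (y |: S).
case: (IH e' A (x |: S) lt_n) => [[R sR cR]|[u [p lp]]].
  by left; exists R => //; apply: walk_separator_to_tail sP sR; apply: setU11.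
case: (IH e' (y |: S) B lt_n) => [[R sR cR]|[v [q lq]]].
  by left; exists R => //; apply: walk_separator_from_head sQ sR; apply: setU11.
(* The bounds force [S] to have exactly [k - 1] vertices and to contain neither [x] nor [y]. *)
right; move: cP cQ; rewrite !cardsU1 => cP cQ.
by apply: (linkage_glue exy sS _ _ _ lp lq); rewrite ?cardsU1; lia.
Qed.

End Walks.

(** * Models of complete graphs versus independent sets *)

Section CompleteModels.
Variables (T : finType) (e : rel T).
Hypothesis e_sym : symmetric e.
Implicit Types (D I U X Y : {set T}) (s : seq {set T}).

Definition rel_in X : rel T := [rel a b | [&& e a b, a \in X & b \in X]].

Definition connected X := [forall a in X, forall b in X, connect (rel_in X) a b].

Definition touch X Y := [exists a in X, exists b in Y, e a b].

Definition independent X := [forall a in X, forall b in X, ~~ e a b].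

(** The branch sets of a complete minor on [size s] vertices. Non-emptiness is asked for separately
    because the empty set counts as [connected]. *)
Definition complete_model s :=
  all (fun X => (X != set0) && connected X) s &&
  pairwise (fun X Y => [disjoint X & Y] && touch X Y) s.

Lemma connectedP X :
  reflect {in X &, forall a b, connect (rel_in X) a b} (connected X).
Proof.
apply: (iffP 'forall_in_forall_inP) => h a b; first by move=> aX; apply: h.
by move=> aX bX; apply: h.
Qed.

Lemma touchP X Y :
  reflect (exists a b, [/\ a \in X, b \in Y & e a b]) (touch X Y).
Proof.
apply: (iffP exists_inP) => [[a aX /exists_inP[b bY eab]]|[a [b [aX bY eab]]]].
  by exists a, b.
by exists a => //; apply/exists_inP; exists b.
Qed.

Lemma independentP X : reflect {in X &, forall a b, ~~ e a b} (independent X).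
Proof.
apply: (iffP 'forall_in_forall_inP) => h a b; first by move=> aX; apply: h.
by move=> aX bX; apply: h.
Qed.

Lemma rel_in_sym X : connect_sym (rel_in X).
Proof. by apply: sym_connect_sym => a b; rewrite /rel_in /= e_sym;
  congr (_ && _); rewrite andbC. Qed.

Lemma connect_rel_inS X Y : X \subset Y ->
  subrel (connect (rel_in X)) (connect (rel_in Y)).
Proof.
move=> sXY; apply: connect_sub => a b /and3P[eab aX bX].
by apply: connect1; rewrite /rel_in /= eab !(subsetP sXY).
Qed.

Lemma connected1 a : connected [set a].
Proof. by apply/connectedP=> b c /set1P-> /set1P->. Qed.

Lemma connectedU1 X a b : connected X -> a \in X -> e a b -> connected (b |: X).
Proof.
move=> /connectedP cX aX eab.
suff h c : c \in b |: X -> connect (rel_in (b |: X)) a c.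
  by apply/connectedP=> c d /h ac /h; apply: connect_trans; rewrite rel_in_sym.
case/setU1P=> [->|cX'].
  by apply: connect1; rewrite /rel_in /= eab setU11 setU1r.
exact: connect_rel_inS (subsetUr _ _) _ _ (cX _ _ aX cX').
Qed.

(* A maximal such [D] leaves no vertex at distance exactly two from it. *)
Lemma connected_2independent U : irreflexive e -> U != set0 ->
  exists D I, [/\ D != set0, D \subset U & I \subset D] /\
    [/\ connected D, independent I & #|D| <= 2 * #|I|] /\
    forall a b, a \in U -> b \in U -> touch D [set a] -> e a b ->
      b \in D \/ touch D [set b].
Proof.
move=> e_irr /set0Pn[x xU].
pose P (DI : {set T} * {set T}) := let: (D, J) := DI in
  [&& D != set0, D \subset U, J \subset D, connected D,
    independent J & #|D| <= 2 * #|J|].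
have Px : P ([set x], [set x]).
  rewrite /P sub1set xU subxx connected1 !cards1 /= andbT; apply/andP; split.
    by apply/set0Pn; exists x; rewrite inE.
  by apply/independentP=> a b /set1P-> /set1P->; rewrite e_irr.
case: (@arg_maxnP _ ([set x], [set x]) P (fun DI => #|DI.1|) Px) => -[D I] PDI maxD.
have /and3P[D0 DU /and4P[ID cD iI le_D]] := PDI.
exists D, I;
  do 2![split=> //] => a b aU bU /touchP[d [a' [dD /set1P-> eda]]] eab.
have [bD|nbD] := boolP (b \in D); first by left.
have [bt|nbt] := boolP (touch D [set b]); first by right.
have nDb c : c \in D -> ~~ e c b.
  by move=> cD'; apply: contra nbt => ecb; apply/touchP; exists c, b;
    rewrite inE.
have naD : a \notin D by apply/negP=> /nDb; rewrite eab.
have aNb : a != b by apply: contraNneq nbt => <-; apply/touchP; exists d, a;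
  rewrite inE.
have cb : #|b |: (a |: D)| = #|D|.+2.
  by rewrite !cardsU1 !inE negb_or eq_sym aNb nbD naD.
(* Otherwise [a] and [b] extend [D] to a larger connected set, while [b], having no neighbour in
   [D], extends [I]: the sizes grow by two and by one, which keeps the ratio and contradicts
   maximality. *)
suff /maxD : P (b |: (a |: D), b |: I) by rewrite /= cb ltnNge leqnSn.
apply/and3P; split; last apply/and4P; last split.
- by apply/set0Pn; exists b; rewrite setU11.
- by rewrite !subUset !sub1set aU bU.
- by apply: setUS; apply: subset_trans ID (subsetUr _ _).
- by apply: connectedU1 eab; rewrite ?setU11 //; apply: connectedU1 eda.
- have nIb c : c \in I -> ~~ e c b by move/(subsetP ID)/nDb.
  move/independentP: iI => iI;
    apply/independentP=> c c' /setU1P[->|cI] /setU1P[->|cI'].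
  + by rewrite e_irr.
  + by rewrite e_sym nIb.
  + exact: nIb.
  + exact: iI.
- have nbI : b \notin I by apply: contra nbD => /(subsetP ID).
  by rewrite cb cardsU1 nbI mulnDr -[_.+2]add2n leq_add2l.
Qed.

(* Duchet and Meyniel's argument: [D] becomes a branch set touching everything
   left in its neighbourhood, and the rest of [U] is not adjacent to that
   neighbourhood, so that independent sets can be merged. *)
Theorem complete_model_or_independent U t : irreflexive e ->
  (exists s, [/\ complete_model s, size s = t & all (fun X => X \subset U) s]) \/
  (exists I, [/\ I \subset U, independent I & #|U| <= 2 * t * #|I|]).
Proof.
move=> e_irr; have [n] := ubnP #|U|; elim: n U t => // n IH U [|t] /ltnSE le_n.
  by left; exists [::].
have [->|U0] := eqVneq U set0.
  by right; exists set0; rewrite cards0 sub0set; split=> //;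
    apply/independentP=> a b; rewrite inE.
have [D [I [[D0 DU ID] [[cD iI le_D] far]]]] := connected_2independent e_irr U0.
have cD0 : 0 < #|D| by rewrite card_gt0.
pose N := [set a in U | (a \notin D) && touch D [set a]].
pose W := U :\: (D :|: N).
have NU : N \subset U by apply/subsetP=> a; rewrite inE => /andP[].
have DN : [disjoint D & N].
  by rewrite disjoints_subset; apply/subsetP=> a aD; rewrite !inE aD andbF.
have cU : #|U| = #|D| + #|N| + #|W|.
  rewrite -(cardsID (D :|: N) U) (setIidPr _) ?subUset ?DU // cardsU.
  by rewrite (disjoint_setI0 DN) cards0 subn0.
(* For [a] in [N] this is [far]: a neighbour in [U] of such a vertex lies in [D] or in [N]. *)
have WDN a b : a \in D :|: N -> b \in W -> ~~ e a b.
  move=> aDN; rewrite !inE => /andP[/norP[nbD nbN] bU]; apply/negP=> eab.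
  rewrite bU nbD /= in nbN; case/negP: nbN.
  case/setUP: aDN => [aD|]; first by apply/touchP; exists a, b; rewrite inE.
  by rewrite !inE => /and3P[aU _ ta]; case: (far a b) => // /negPn; rewrite nbD.
(* Induct on [W] with the same target, and on [N] with a target one smaller, since [D] supplies the
   missing branch set. *)
have [|[s [ms <- sW]]|[J [JW iJ le_J]]] := IH W t.+1; first by lia.
  left; exists s; split=> //; apply: sub_all sW => X /subset_trans; apply.
  exact: subsetDl.
have [|[s [/andP[ms1 ms2] ss sN]]|[K [KN iK le_K]]] := IH N t; first by lia.
  left; exists (D :: s); rewrite /= ss DU; split=> //; last first.
    by apply: sub_all sN => X /subset_trans; apply.
  rewrite /complete_model /= D0 cD ms1 ms2 /= andbT; apply/allP=> X Xs.
  have XN := allP sN _ Xs; have /andP[/set0Pn[a aX] _] := allP ms1 _ Xs.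
  rewrite (disjointWr XN DN); have := subsetP XN _ aX; rewrite inE.
  by case/and3P=> _ _ /touchP[d [_ [dD /set1P-> eda]]]; apply/touchP;
    exists d, a.
(* [L] is the larger of [I] and [K]; it bounds both [D] and [N]. *)
have [L [LDN iL le_IL le_KL]]
  : exists L : {set T}, [/\ L \subset D :|: N, independent L,
      #|I| <= #|L| & #|K| <= #|L|].
  have [le_KI|/ltnW le_IK] := leqP #|K| #|I|; [exists I|exists K]; split=> //.
    exact: subset_trans ID (subsetUl _ _).
  exact: subset_trans KN (subsetUr _ _).
right; exists (L :|: J); split.
- rewrite subUset (subset_trans LDN) ?subUset ?DU //.
  by rewrite (subset_trans JW) ?subsetDl.
- move/independentP: iL => iL; move/independentP: iJ => iJ.
  apply/independentP=> a b /setUP[aL|aJ] /setUP[bL|bJ];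
    [exact: iL| | |exact: iJ].
    by apply: WDN; [apply: (subsetP LDN)|apply: (subsetP JW)].
  by rewrite e_sym; apply: WDN; [apply: (subsetP LDN)|apply: (subsetP JW)].
- have -> : #|L :|: J| = #|L| + #|J|.
    rewrite cardsU (disjoint_setI0 _) ?cards0 ?subn0 // disjoint_subset.
    apply/subsetP=> a /(subsetP LDN) aDN; rewrite inE;
      apply/negP=> /(subsetP JW).
    by rewrite inE aDN.
  (* With t the predecessor of the target, |D| + |N| + |W| is at most 2|L| + 2t|L| + 2(t+1)|J| =
     2(t+1)(|L| + |J|). *)
  nia.
Qed.

End CompleteModels.

(** * From branch sets to minors by edge contraction *)

(** A path of indices in [M] lifts to the union: move inside [V i] to an edge leading to the next
    set, cross it, and repeat. *)
Lemma connected_bigcup (T I : finType) (e : rel T) (q : rel I)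
    (V : I -> {set T}) (M : {set I}) :
    symmetric e -> (forall i, connected e (V i)) ->
    (forall i j, q i j -> touch e (V i) (V j)) ->
  connected q M -> connected e (\bigcup_(i in M) V i).
Proof.
move=> e_sym cV tV /connectedP cM; set X := \bigcup_(i in M) V i.
have sV i : i \in M -> V i \subset X by move=> iM; apply: bigcup_sup.
have inV i a b : i \in M -> a \in V i -> b \in V i -> connect (rel_in e X) a b.
  move=> iM aV bV; apply: connect_rel_inS (sV _ iM) _ _ _.
  by have /connectedP := cV i; apply.
apply/connectedP=> a b /bigcupP[i iM aV] /bigcupP[j jM bV].
have /connectP[p pp lj] := cM i j iM jM.
elim: p i a iM aV pp lj => [|h p IH] i a iM aV /=.
  by move=> _ ej; rewrite ej in bV; apply: (inV i).
case/andP=> /and3P[qih _ hM] pp lj.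
have /touchP[c [d [cV' dV ecd]]] := tV _ _ qih.
apply: connect_trans (inV i _ _ iM aV cV') (connect_trans _ (IH h d hM dV pp lj)).
by apply: connect1;
  rewrite /rel_in /= ecd (subsetP (sV _ iM)) ?(subsetP (sV _ hM)).
Qed.

Lemma connected_path (T : finType) (e : rel T) x (p : seq T) : symmetric e ->
  path e x p -> connected e [set z in x :: p].
Proof.
move=> e_sym; elim/last_ind: p => [|p y IH].
  have -> : [set z in [:: x]] = [set x] by apply/setP=> z; rewrite !inE.
  by rewrite connected1.
rewrite rcons_path => /andP[/IH cp ey].
have -> : [set z in x :: rcons p y] = y |: [set z in x :: p].
  by apply/setP=> z; rewrite !inE mem_rcons inE orbCA.
by apply: connectedU1 ey; rewrite // inE mem_last.
Qed.

(** Induction on the number of vertices. An injective [f] is an isomorphism; otherwise some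
    connected fibre contains an edge, and contracting it preserves all four hypotheses. *)
Lemma contracts_to_fibers (G H : sgraph) (f : G -> H) :
    (forall h, exists a, f a = h) ->
    (forall a b, f a = f b -> connect [rel a b | adj a b && (f a == f b)] a b) ->
    (forall a b, adj a b -> f a = f b \/ adj (f a) (f b)) ->
    (forall h h', adj h h' -> exists a b, [/\ f a = h, f b = h' & adj a b]) ->
  contracts_to G H.
Proof.
have [n] := ubnP #|G|; elim: n G f => // n IH G f /ltnSE le_n surj fib out lift.
have [/injectiveP inj|/injectivePn[a [b ab fab]]] := boolP (injectiveb f).
  apply: contracts_iso; exists f.
    have [g gK] := fin_all_exists surj.
    by exists g => // a; apply: inj; rewrite gK.
  move=> a b; apply/idP/idP => [/lift[a' [b' [/inj-> /inj->]]]//|ab].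
  case: (out a b ab) => // /inj eab.
  by rewrite eab adj_irrefl in ab.
have {a b ab fab} [u [v [uv fuv]]] : exists u v, adj u v /\ f u = f v.
  have /connectP[[|c p] /=] := fib a b fab; first by move=> _ eab;
    rewrite eab eqxx in ab.
  by case/andP=> /andP[ac /eqP fac] _ _; exists a, c.
have uNv : u != v by apply/negP=> /eqP euv; rewrite euv adj_irrefl in uv.
apply: (contracts_edge uv).
pose u' : Defs.contract u v := exist _ u uNv.
(* The quotient map of the contraction: the default value [u'] of [insubd] sends [v] to [u]. *)
pose pi (a : G) : Defs.contract u v := insubd u' a.
have piN a : a != v -> val (pi a) = a by move=> av; rewrite /pi val_insubd av.
have piv : val (pi v) = u by rewrite /pi val_insubd eqxx.
have piK (a : Defs.contract u v) : pi (val a) = a by rewrite /pi valKd.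
have fpi a : f (val (pi a)) = f a.
  by have [->|/piN->//] := eqVneq a v; rewrite piv.
have piadj a b : adj a b -> pi a = pi b \/ adj (pi a) (pi b).
  move=> ab; have [e|ne] := eqVneq (pi a) (pi b); [by left|right].
  rewrite /adj /= /contract_adj ne /=.
  have [av|av] := eqVneq a v; have [bv|bv] := eqVneq b v.
  - by rewrite av bv adj_irrefl in ab.
  - by rewrite av piv eqxx (piN _ bv) -av ab orbT.
  - by rewrite bv piv eqxx (piN _ av) -bv [adj b a]adj_sym ab !orbT.
  - by rewrite !piN ?ab.
apply: (IH (Defs.contract u v) (fun a => f (val a))); rewrite /=.
- apply: leq_trans le_n; rewrite card_sig (eq_card (B := predC1 v)) // cardC1.
  by rewrite prednK //; apply/card_gt0P; exists v.
- by move=> h; have [a <-] := surj h; exists (pi a); rewrite /= fpi.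
- move=> a b /= /fib /connectP[p pp lp].
  (* Fibres stay connected because [pi] maps a path inside a fibre of [f] to a walk inside the
     corresponding fibre, up to repeated vertices. *)
  suff h c : path [rel a b | adj a b && (f a == f b)] c p ->
      connect [rel a b : Defs.contract u v | adj a b && (f (val a) == f (val b))]
        (pi c) (pi (last c p)).
    by have := h _ pp; rewrite -lp !piK.
  elim: p c {pp lp} => [|d p IHp] c //= /andP[/andP[cd /eqP fcd] pp].
  apply: connect_trans (IHp d pp); have [->//|pcd] := piadj _ _ cd.
  by apply: connect1; apply/andP; rewrite !fpi fcd eqxx.
- move=> a b /= /andP[_ /or3P[/out//|/andP[/eqP-> /out]|/andP[/eqP-> /out]]].
    by rewrite fuv.
  by rewrite fuv => -[->|]; [left|rewrite adj_sym; right].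
- move=> h h' hh'; have [a [b [fa fb ab]]] := lift _ _ hh'.
  exists (pi a), (pi b); rewrite /= !fpi; split=> //.
  have [pab|//] := piadj _ _ ab; move: (congr1 (fun a => f (val a)) pab);
    rewrite /= !fpi fa fb.
  by move=> ehh; rewrite ehh adj_irrefl in hh'.
Qed.

Section MinorOfModel.
Variables (G H : sgraph) (b : H -> {set G}).
Hypothesis b_neq0 : forall h, b h != set0.
Hypothesis b_conn : forall h, connected (@adj G) (b h).
Hypothesis b_inj : forall h h' a, a \in b h -> a \in b h' -> h = h'.
Hypothesis b_touch : forall h h', adj h h' -> touch (@adj G) (b h) (b h').

Local Notation covered := {a : G | [exists h, a \in b h]}.

Definition branch_of (a : covered) : H := xchoose (existsP (valP a)).

Lemma branch_ofP a : val a \in b (branch_of a).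
Proof. exact: xchooseP (existsP (valP a)). Qed.

(** Edges between branch sets of non-adjacent vertices of [H] are dropped, so that contracting the
    branch sets yields [H] exactly and not a supergraph. *)
Definition model_adj : rel covered := fun x y => adj (val x) (val y) &&
  ((branch_of x == branch_of y) || adj (branch_of x) (branch_of y)).

Lemma model_adj_sym : symmetric model_adj.
Proof. by move=> x y;
  rewrite /model_adj adj_sym eq_sym [adj (branch_of x) _]adj_sym. Qed.

Lemma model_adj_irrefl : irreflexive model_adj.
Proof. by move=> x; rewrite /model_adj adj_irrefl. Qed.

Definition model_graph := SGraph model_adj_sym model_adj_irrefl.

Lemma minor_of_model : minor H G.
Proof.
exists model_graph.
  by exists val; [exact: val_inj | move=> x y /andP[]].
have lft h a : a \in b h -> exists2 x : model_graph, val x = a & branch_of x = h.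
  move=> ah; have aC : [exists h, a \in b h] by apply/existsP; exists h.
  by exists (exist _ a aC) => //; apply: b_inj ah;
    exact: (branch_ofP (exist _ a aC)).
apply: (@contracts_to_fibers model_graph H branch_of).
- by move=> h; have /set0Pn[a /lft[x _ <-]] := b_neq0 h; exists x.
- move=> x y exy; have := branch_ofP x; have := branch_ofP y;
    rewrite -exy => yh xh.
  (* A path inside the branch set lifts vertex by vertex to [model_graph], since edges within one
     branch set are kept. *)
  have /connectedP/(_ _ _ xh yh)/connectP[p pp lp] := b_conn (branch_of x).
  elim: p x xh pp lp {exy} yh => [|c p IH] x xh /=.
    by move=> _ /val_inj->.
  case/andP=> /and3P[xc _ /lft[z zc zh]] pp lp yh.
  have zb := branch_ofP z; rewrite zc zh in zb.
  apply: connect_trans (connect1 _) (IH z _ _ _ _); rewrite ?zc ?zh //.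
  by rewrite /= /model_adj zh eqxx zc xc.
- by move=> x y /andP[_ /orP[/eqP|]]; [left|right].
- move=> h h' hh';
    have /touchP[a [c [/lft[x xa xh] /lft[y yc yh] ac]]] := b_touch hh'.
  by exists x, y; split=> //; rewrite /= /model_adj xa yc xh yh ac hh' orbT.
Qed.

End MinorOfModel.

(** Composes two levels of branch sets: those of [s] over the indices, and the sets [V i] over [G].
    As all pairs in [s] touch, any numbering of the vertices of [H] will do. *)
Lemma minor_of_complete_model (G H : sgraph) (I : finType) (q : rel I)
    (V : I -> {set G}) (s : seq {set I}) :
    symmetric q ->
    (forall i, V i != set0) -> (forall i, connected (@adj G) (V i)) ->
    (forall i j z, z \in V i -> z \in V j -> i = j) ->
    (forall i j, q i j -> touch (@adj G) (V i) (V j)) ->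
  complete_model q s -> size s = #|H| -> minor H G.
Proof.
move=> q_sym V0 cV dV tV /andP[/allP ms1 /pairwiseP ms2] ss.
pose M (h : H) := nth set0 s (enum_rank h).
have rk (h : H) : enum_rank h < size s by rewrite ss.
have Ms h : M h \in s by apply: mem_nth.
have MM h h' : h != h' -> [disjoint M h & M h'] && touch q (M h) (M h').
  move=> hh'; have : (enum_rank h : nat) != enum_rank h'.
    by apply: contra hh' => /eqP/val_inj/enum_rank_inj->.
  rewrite neq_ltn => /orP[lt|lt]; have := ms2 set0 _ _ (rk _) (rk _) lt;
    first by [].
  rewrite disjoint_sym => /andP[-> /touchP[i [j [ij jj qij]]]].
  by apply/touchP; exists j, i; rewrite q_sym.
apply: (@minor_of_model G H (fun h => \bigcup_(i in M h) V i)).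
- move=> h; have /andP[/set0Pn[i iM] _] := ms1 _ (Ms h);
    have /set0Pn[a aV] := V0 i.
  by apply/set0Pn; exists a; apply/bigcupP; exists i.
- move=> h; have /andP[_ cM] := ms1 _ (Ms h).
  by apply: connected_bigcup cM => //; apply: adj_sym.
- move=> h h' a /bigcupP[i iM aV] /bigcupP[j jM aV'].
  have [//|/MM/andP[dM _]] := eqVneq h h'.
  have ij := dV _ _ _ aV aV'; rewrite -ij in jM.
  by move: (disjointFr dM iM); rewrite jM.
- move=> h h' hh'; have /MM/andP[_ /touchP[i [j [iM jM qij]]]] : h != h'.
    by apply: contraTneq hh' => ->; rewrite adj_irrefl.
  have /touchP[a [c [aV cV' ac]]] := tV _ _ qij.
  by apply/touchP; exists a, c; split=> //; apply/bigcupP; [exists i|exists j].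
Qed.

(** * Anticomplete paths, and the bound on the separator *)

Lemma anticomplete_paths_or_separator (G H : sgraph) (A B : {set G}) (k : nat) :
    ~ minor H G ->
  (exists P : 'I_k -> seq G,
     (forall i, is_ABpath A B (P i)) /\
     (forall i j, i != j ->
        vertex_disjoint (P i) (P j) /\ anticomplete (P i) (P j))) \/
  (exists S : {set G}, separator A B S /\ #|S| <= 2 * #|H| * k).
Proof.
move=> noH; set n := 2 * #|H| * k.
case: (menger (@adj G) A B n) => [[S sS cS]|[x [p [wp dp]]]].
  right; exists S; split; last exact: ltnW.
  by move=> [//|a r] /andP[/andP[pr _] /andP[aA lB]]; apply: sS; apply/and3P.
left; pose V i : {set G} := [set z in x i :: p i].
(* Distinct indices are required because a path with an edge touches itself, while [q] has to be
   irreflexive. *)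
pose q : rel 'I_n := [rel i j | (i != j) && touch (@adj G) (V i) (V j)].
have q_sym : symmetric q.
  move=> i j; rewrite /q /= eq_sym; congr (_ && _).
  by apply/touchP/touchP=> -[a [b [aV bV ab]]]; exists b, a; rewrite adj_sym.
have q_irr : irreflexive q by move=> i; rewrite /q /= eqxx.
have noK s : complete_model q s -> size s <> #|H|.
  move=> ms ss; apply: noH;
    apply: (minor_of_complete_model (V := V)) ms ss => //.
  - by move=> i; apply/set0Pn; exists (x i); rewrite inE mem_head.
  - by move=> i; have [/and3P[pp _ _] _] := wp i; apply: connected_path pp;
      apply: adj_sym.
  - by move=> i j z; rewrite !in_set; apply: dp.
  - by move=> i j /andP[].
case: (complete_model_or_independent q_sym [set: 'I_n] #|H| q_irr).
  by move=> [s [/noK]].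
case=> I [_ /independentP iI]; rewrite cardsT card_ord leq_mul2l muln_eq0 /=.
(* For empty [H] the empty model would already give a minor; non-emptiness lets the factor
   [2 * #|H|] be cancelled, leaving at least [k] indices in [I]. *)
have H0 : #|H| != 0 by apply/eqP=> h0; apply: (noK [::]).
rewrite (negPf H0) /= => le_k.
pose j (i : 'I_k) := enum_val (widen_ord le_k i).
have j_inj : injective j by move=> i i' /enum_val_inj/(congr1 val) /= /val_inj.
exists (fun i => x (j i) :: p (j i)); split=> [i|i i' ii'].
  have [/and3P[pp aA lB] up] := wp (j i).
  by rewrite /is_ABpath /is_path pp up aA lB.
split=> [z [zi zi']|a b ai bi'].
  by move: ii'; rewrite -(inj_eq j_inj) (dp _ _ _ zi zi') eqxx.
have := iI _ _ (enum_valP (widen_ord le_k i)) (enum_valP (widen_ord le_k i')).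
rewrite -/(j i) -/(j i') /q /= (inj_eq j_inj) ii' /=; apply: contra => ab.
by apply/touchP; exists a, b; rewrite !in_set.
Qed.

Local Open Scope ring_scope.

Theorem theorem1p2 (R : realType) :
  exists g : sgraph -> R,
    (exists (C : R) (N : nat), forall H : sgraph, (N <= #|H|)%N ->
       `|g H| <= C * (#|H|%:R * Num.sqrt (ln (#|H|%:R)))) /\
    (forall H G : sgraph, ~ minor H G ->
     forall (A B : {set G}) (k : nat), (0 < k)%N ->
       (exists P : 'I_k -> seq G,
          (forall i, is_ABpath A B (P i)) /\
          (forall i j, i != j ->
             vertex_disjoint (P i) (P j) /\ anticomplete (P i) (P j))) \/
       (exists S : {set G},
          separator A B S /\ #|S|%:R <= k%:R * g H)).
Proof.
exists (fun H : sgraph => (2 * #|H|)%N%:R); split; last first.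
  move=> H G noH A B k _; case: (anticomplete_paths_or_separator A B k noH).
    by left.
  move=> [S [sS le_S]]; right; exists S; split=> //.
  by rewrite mulrC -natrM ler_nat.
have ln2_gt0 : 0 < ln (2%:R : R) by rewrite ln_gt0 // ltr1n.
have sqrt2_gt0 : 0 < Num.sqrt (ln (2%:R : R)) by rewrite sqrtr_gt0.
(* For at least two vertices the square root is at least that of [ln 2], so this constant absorbs
   the factor 2. The threshold excludes one vertex, where the logarithm vanishes. *)
exists (2%:R / Num.sqrt (ln 2%:R)), 2%N => H H2.
rewrite normr_nat natrM -mulrA ler_wpM2l // mulrCA ler_peMr //.
rewrite ler_pdivlMl // mulr1 ler_wsqrtr // ler_ln ?posrE ?ltr0n ?ler_nat //.
exact: leq_trans H2.
Qed.
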